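(* Let $X$ be a first countable Hausdorff space which admits a non-trivial convergent sequence, and let $\mathcal{I}_\varphi$ be an analytic P-ideal on $\mathbf{N}$, represented by a lower semicontinuous submeasure $\varphi$ with $\varphi(\mathbf{N})<\infty$ as $\mathcal{I}_\varphi=\{A\subseteq\mathbf{N}:\|A\|_\varphi=0\}$. Then the following are equivalent: (i) $\mathcal{I}_\varphi$ is also an $F_\sigma$-ideal; (ii) $\Lambda_x(\mathcal{I}_\varphi)=\Gamma_x(\mathcal{I}_\varphi)$ for all sequences $x$ taking values in $X$; (iii) $\Lambda_x(\mathcal{I}_\varphi)$ is closed for all sequences $x$ taking values in $X$; (iv) there does not exist a partition $\{A_n:n\in\mathbf{N}\}$ of $\mathbf{N}$ such that $\|A_n\|_\varphi>0$ for all $n$ and $\lim_n\left\|\bigcup_{k>n}A_k\right\|_\varphi=0$.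
   Context: $\mathbf{N}$ denotes the positive integers. An ideal $\mathcal{I}$ on $\mathbf{N}$ is a collection of subsets of $\mathbf{N}$ closed under finite unions and subsets; it is assumed to contain the family $\mathrm{Fin}$ of finite subsets of $\mathbf{N}$ and to be different from $\mathcal{P}(\mathbf{N})$. Identifying subsets of $\mathbf{N}$ with their characteristic functions, $\mathcal{P}(\mathbf{N})$ carries the Cantor-space topology of $\{0,1\}^{\mathbf{N}}$; an $F_\sigma$-ideal is an ideal which is an $F_\sigma$-subset of this space. A map $\varphi:\mathcal{P}(\mathbf{N})\to[0,\infty]$ is a lower semicontinuous submeasure if $\varphi(\emptyset)=0$; $\varphi(A)\le\varphi(B)$ whenever $A\subseteq B$; $\varphi(A\cup B)\le\varphi(A)+\varphi(B)$ for all $A,B$; and $\varphi(A)=\lim_n\varphi(A\cap\{1,\ldots,n\})$ for all $A$. Put $\|A\|_\varphi:=\lim_n\varphi(A\setminus\{1,\ldots,n\})$. By a theorem of Solecki, an ideal $\mathcal{I}$ on $\mathbf{N}$ is an analytic P-ideal if and only if $\mathcal{I}=\mathcal{I}_\varphi:=\{A\subseteq\mathbf{N}:\|A\|_\varphi=0\}$ for some lower semicontinuous submeasure $\varphi$ with $\varphi(\mathbf{N})<\infty$; an analytic P-ideal is always written as $\mathcal{I}_\varphi$ for such a fixed $\varphi$. $\Lambda_x(\mathcal{I})$ (the $\mathcal{I}$-limit points of $x=(x_n)$) is the set of all $\ell\in X$ such that $\lim_{k\to\infty}x_{n_k}=\ell$ for some subsequence $(x_{n_k})$ with $\{n_k:k\in\mathbf{N}\}\notin\mathcal{I}$.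 $\Gamma_x(\mathcal{I})$ (the $\mathcal{I}$-cluster points of $x$) is the set of all $\ell\in X$ such that $\{n:x_n\in U\}\notin\mathcal{I}$ for every neighborhood $U$ of $\ell$. $X$ admits a non-trivial convergent sequence if there are $\ell\in X$ and a sequence $(\ell_n)$ in $X$ converging to $\ell$ with $\ell_n\neq\ell$ for all $n$. *)

(* Defs.v *)
From mathcomp Require Import all_boot all_order all_algebra.
From mathcomp Require Import all_classical all_reals all_analysis.
From mathcomp Require Import borel_hierarchy.

Set Implicit Arguments.
Unset Strict Implicit.
Unset Printing Implicit Defensive.

Local Open Scope classical_set_scope.
Local Open Scope ereal_scope.

(* The positive integers are indexed from zero: [n : nat] stands for n + 1, so
   that the initial segment {1, ..., n} is [`I_n]. *)

Definition ideal (I : set (set nat)) : Prop :=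
  [/\ forall A B, I A -> I B -> I (A `|` B),
      forall A B, A `<=` B -> I B -> I A,
      forall A, finite_set A -> I A
    & I <> [set: set nat]].

(* [I] is transported to the Cantor space {0,1}^nat by identifying a set with
   its characteristic function. *)
Definition Fsigma_ideal (I : set (set nat)) : Prop :=
  ideal I /\ Fsigma [set c : cantor_space | I [set n | c n]].

Section Submeasure.
Context {R : realType}.
Implicit Types (phi : set nat -> \bar R) (A B : set nat).

Definition lsc_submeasure phi : Prop :=
  [/\ forall A, 0 <= phi A,
      phi set0 = 0,
      forall A B, A `<=` B -> phi A <= phi B,
      forall A B, phi (A `|` B) <= phi A + phi B
    & forall A, phi (A `&` `I_n) @[n --> \oo] --> phi A].

Definition submeasure_norm phi A : \bar R :=
  limn (fun n => phi (A `\` `I_n)).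

Definition exh phi : set (set nat) := [set A | submeasure_norm phi A = 0].

End Submeasure.

Section Topology.
Context {X : topologicalType}.
Implicit Types (x : nat -> X) (I : set (set nat)).

Definition limit_points x I : set X :=
  [set l | exists k : nat -> nat,
    [/\ increasing_seq k, x (k n) @[n --> \oo] --> l & ~ I (range k)]].

Definition cluster_points x I : set X :=
  [set l | forall U, nbhs l U -> ~ I (x @^-1` U)].

End Topology.

Definition first_countable (X : topologicalType) : Prop :=
  forall p : X, exists B : set (set X),
    [/\ countable B, forall U, B U -> nbhs p U
      & forall U, nbhs p U -> exists2 V, B V & V `<=` U].

Definition nontrivial_convergent_sequence (X : topologicalType) : Prop :=
  exists (l : X) (u : nat -> X),
    u n @[n --> \oo] --> l /\ forall n, u n <> l.

(* Main.v *)
Require Import Defs.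
From mathcomp Require Import all_boot all_order all_algebra.
From mathcomp Require Import all_classical all_reals all_analysis.
From mathcomp Require Import borel_hierarchy lra.

(* (i) => (ii): F_sigma ideals I have a diagonal property: below a decreasing
   sequence of sets A_n outside I there is a set B outside I with B \ A_n finite
   for all n.  Apply it to A_n = {i : x_i in U_n}, U_n a decreasing base at l.
   (iii) => (iv): if x takes the value l_n on the block A_n of a partition as in
   (iv), and l_n -> l, then each l_n is a limit point of x, but l is not: a
   subsequence tending to l meets each block in a finite set, so it lies, up to
   a finite set, in tails of the partition of arbitrarily small norm.
   (iv) => (i): if no set has norm in ]0, d], then exh phi is the union over m of
   the closed sets {A : phi (A \ `I_m) <= d}.  Otherwise there are sets B_n of
   positive norm such that phi (B_(n+1)) is at most a quarter of the norm of B_n;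
   removing from B_n all later B_k leaves a partition violating (iv). *)

Import Order.TTheory GRing.Theory Num.Theory.
Local Open Scope classical_set_scope.
Local Open Scope ereal_scope.

(** * Enumerations of sets of integers and countable neighborhood bases *)

Lemma increasing_seq_ge (k : nat -> nat) n : increasing_seq k -> (n <= k n)%N.
Proof.
move=> /increasing_seqP kS; elim: n => // n ih.
exact: leq_ltn_trans ih (kS n).
Qed.

Lemma infinite_nat_enum (A : set nat) : infinite_set A ->
  exists2 k : nat -> nat, increasing_seq k & range k = A.
Proof.
move=> Ainf.
have /choice[f fP] (m : nat) : exists a : nat,
    [/\ A a, (m <= a)%N & forall b, A b -> (m <= b)%N -> (a <= b)%N].
  have ex_a : exists a, (a \in A) && (m <= a)%N.
    apply: contrapT => nex; apply: Ainf; apply: sub_finite_set (finite_II m).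
    move=> a Aa /=; rewrite ltnNge; apply/negP => ma.
    by apply: nex; exists a; rewrite ma andbT inE.
  exists (ex_minn ex_a); case: ex_minnP => a /andP[/set_mem Aa ma] amin.
  split=> // b Ab mb; apply: amin; rewrite mb andbT; exact/mem_set.
pose k := fix k n := if n is n'.+1 then f (k n').+1 else f 0%N.
have kS n : (k n < k n.+1)%N by have [] := fP (k n).+1.
have kincr : increasing_seq k by exact/increasing_seqP.
exists k => //.
rewrite eqEsubset; split=> [_ [[|n] _ <-]|a Aa]; first by have [] := fP 0%N.
  by have [] := fP (k n).+1.
(* Induction on a bound [k n] of [a]: unless an earlier [k] already bounds [a], minimality in the
   choice of [k n] forces [k n = a]. *)
have [n] : exists n, (a <= k n)%N by exists a; exact: increasing_seq_ge.
elim: n => [|n ih] akn.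
  exists 0%N => //; apply/eqP; rewrite eqn_leq akn andbT.
  by have [_ _] := fP 0%N; apply.
have [/ih//|kna] := leqP a (k n).
exists n.+1 => //; apply/eqP; rewrite eqn_leq akn andbT.
by have [_ _] := fP (k n).+1; apply.
Qed.

Lemma first_countable_decreasing_base (X : topologicalType) (p : X) :
  first_countable X -> exists U : nat -> set X,
    [/\ forall n, nbhs p (U n), forall m n, (m <= n)%N -> U n `<=` U m
      & forall V, nbhs p V -> exists n, U n `<=` V].
Proof.
move=> /(_ p)[B [Bcount Bp Bbase]].
have [W [WB BW]] : exists W : nat -> set X,
    (forall n, nbhs p (W n)) /\ forall V, B V -> exists n, W n = V.
  have /pfcard_geP[B0|[g]] := Bcount.
    by exists (fun=> setT); split=> [n|V]; [exact: filterT|rewrite B0].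
  exists g; split=> [n|V BV]; first by apply: Bp; exact: funS.
  by have [n _ <-] := @surj _ _ _ _ g _ BV; exists n.
pose U := fix U n := if n is n'.+1 then U n' `&` W n else W 0%N.
have UW n : U n `<=` W n by case: n => // n x [].
exists U; split=> [n|m n|V /Bbase[B' /BW[n <-] WV]].
- by elim: n => [|n ih] /=; [exact: WB|exact: filterI].
- by elim: n m => [|n ih] m; [case: m|rewrite leq_eqVlt => /predU1P[->//|/ih mn x /= [/mn]]].
- by exists n => x /UW /WV.
Qed.

(** * Closed subsets of the Cantor space and F_sigma ideals *)

Lemma cantor_nbhs_prefix (c : cantor_space) N :
  nbhs c [set c' : cantor_space | forall i, (i < N)%N -> c' i = c i].
Proof.
elim: N => [|N ih]; first by apply: filterS filterT.
have cN : nbhs c [set c' : cantor_space | c' N = c N].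
  apply: (@proj_continuous nat (fun=> bool) N c [set c N]).
  exact: discrete_set1.
apply: filterS2 ih cN => c' /= c'c c'N i; rewrite ltnS leq_eqVlt.
by move=> /predU1P[->|/c'c].
Qed.

(** By compactness: if every prefix of [A] were contained in a member of [F], a cluster point of
    these members would lie in [F] and contain all of [A], putting [A] in [I]. *)
Lemma closed_cantor_prefix {I : set (set nat)} {F : set cantor_space}
    {A : set nat} :
  (forall A B, A `<=` B -> I B -> I A) -> closed F ->
  F `<=` [set c : cantor_space | I [set n | c n]] -> ~ I A ->
  exists N, forall c : cantor_space, F c -> ~ A `&` `I_N `<=` [set n | c n].
Proof.
move=> Isub Fclosed FI nIA; apply: contrapT => nN.
have /choice[c cP] N : exists c : cantor_space,
    F c /\ A `&` `I_N `<=` [set n | c n].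
  apply: contrapT => nc; apply: nN; exists N => c Fc Ac.
  by apply: nc; exists c.
have Fcpt : compact F.
  by apply: (@subclosed_compact _ _ [set: cantor_space]) => //; exact: cantor_space_compact.
have [p [Fp pc]] : F `&` cluster (c @ \oo) !=set0.
  by apply: Fcpt; exists 0%N => // n _ /=; have [] := cP n.
apply: nIA; apply: Isub (FI _ Fp) => i Ai /=.
have [] := pc [set d : cantor_space | d i]
              [set d : cantor_space | forall j, (j < i.+1)%N -> d j = p j] _
              (cantor_nbhs_prefix p i.+1).
  exists i.+1 => // n /= ni; have [_] := cP n; apply; split => //.
by move=> d [/= di dp]; rewrite -dp.
Qed.

(** The union of finite prefixes, the [n]-th one excluding membership in [F n], escapes every closed
    piece. As [A] decreases, only the prefixes of index below [n] can leave [A n]. *)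
Lemma Fsigma_ideal_diagonal (I : set (set nat)) (A : nat -> set nat) :
  Fsigma_ideal I -> (forall m n, (m <= n)%N -> A n `<=` A m) ->
  (forall n, ~ I (A n)) ->
  exists2 B, ~ I B & forall n, exists N, B `\` A n `<=` `I_N.
Proof.
move=> [[_ Isub _ _] [F Fclosed IF]] Adec nIA.
have FI n : F n `<=` [set c : cantor_space | I [set n | c n]].
  by rewrite IF => c Fc; exists n.
have /choice[g gP] n := closed_cantor_prefix Isub (Fclosed n) (FI n) (nIA n).
(* No member of F n contains the prefix [A n `&` `I_(g n)] of A n. *)
exists (\bigcup_n (A n `&` `I_(g n))) => [IB|n].
  pose c : cantor_space := fun i => i \in \bigcup_n (A n `&` `I_(g n)).
  have cE : [set i | c i] = \bigcup_n (A n `&` `I_(g n)).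
    by apply/seteqP; split=> i; [move/set_mem|move/mem_set].
  have : [set c : cantor_space | I [set n | c n]] c by rewrite /= cE.
  rewrite IF => -[n _ Fnc]; apply: (gP n c Fnc); rewrite cE.
  by move=> i Ai; exists n.
exists (\max_(k < n) g k) => i [[k _ [Aki gki]] nAni] /=.
have kn : (k < n)%N by rewrite ltnNge; apply/negP => nk; apply: nAni; exact: Adec Aki.
exact: leq_trans gki (leq_bigmax (F := fun k : 'I_n => g k) (Ordinal kn)).
Qed.

(** * Limit points and cluster points along an ideal *)

Section IdealPoints.
Context {X : topologicalType} {I : set (set nat)} (I_ideal : ideal I).

Lemma not_ideal_infinite A : ~ I A -> infinite_set A.
Proof. by move=> nIA Afin; apply: nIA; case: I_ideal => _ _ + _; apply. Qed.

Lemma limit_points_sub_cluster (x : nat -> X) :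
  limit_points x I `<=` cluster_points x I.
Proof.
move=> l [k [kincr xl nIk]] U Ul IU; apply: nIk.
have [IU2 Isub Ifin _] := I_ideal.
have [N _ NU] := xl _ Ul.
apply: (Isub _ (x @^-1` U `|` k @` `I_N)).
  move=> _ [n _ <-]; have [nN|nN] := ltnP n N; first by right; exists n.
  by left; exact: NU.
by apply: IU2 => //; apply/Ifin/finite_image/finite_II.
Qed.

Lemma Fsigma_cluster_sub_limit_points (x : nat -> X) :
  first_countable X -> Fsigma_ideal I ->
  cluster_points x I `<=` limit_points x I.
Proof.
move=> Xfc Ifs l lcl.
have [U [Ul Udec Ubase]] := first_countable_decreasing_base X l Xfc.
have [|n|B nIB Bfin] := Fsigma_ideal_diagonal I (fun n => x @^-1` U n) Ifs.
- by move=> m n mn i /= /(Udec _ _ mn).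
- exact: lcl.
have [k kincr kB] := infinite_nat_enum _ (not_ideal_infinite _ nIB).
exists k; split => //; last by rewrite kB.
move=> V /Ubase[n UV]; have [N NB] := Bfin n.
exists N => // j /= Nj; apply: UV; apply: contrapT => nUn.
have /NB /= : (B `\` x @^-1` U n) (k j) by split => //; rewrite -kB; exists j.
by rewrite ltnNge (leq_trans Nj) ?increasing_seq_ge.
Qed.

Lemma closed_cluster_points (x : nat -> X) : closed (cluster_points x I).
Proof.
move=> l lcl U; rewrite nbhsE => -[V [Vo Vl] VU] IU.
have [l' [/(_ V) l'cl Vl']] := lcl _ (open_nbhs_nbhs (conj Vo Vl)).
apply: l'cl; first exact: open_nbhs_nbhs.
by have [_ Isub _ _] := I_ideal; apply: Isub IU => n /= /VU.
Qed.
End IdealPoints.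

(** * The norm of a finite lower semicontinuous submeasure *)

Section Submeasure.
Context {R : realType} {phi : set nat -> \bar R}.
Context (phi_lsc : lsc_submeasure phi) (phi_fin : phi [set: nat] < +oo).
Local Notation N := (submeasure_norm phi).

Let phi_ge0 A : 0 <= phi A. Proof. by have [+ _ _ _ _] := phi_lsc; apply. Qed.

Let phi_mono A B : A `<=` B -> phi A <= phi B.
Proof. by have [_ _ + _ _] := phi_lsc; apply. Qed.

Let phiU A B : phi (A `|` B) <= phi A + phi B.
Proof. by have [_ _ _ + _] := phi_lsc; apply. Qed.

Lemma submeasure_fin_num A : phi A \is a fin_num.
Proof.
by rewrite ge0_fin_numE//; apply: le_lt_trans phi_fin; exact: phi_mono.
Qed.

(** Lower semicontinuity in the form used below: it makes tail conditions closed and reduces bounds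
    on infinite unions to finite ones. *)
Lemma submeasure_le_prefix A t :
  (forall n, phi (A `&` `I_n) <= t) -> phi A <= t.
Proof.
move=> At; have [_ _ _ _ /(_ A) cvgA] := phi_lsc.
by apply: cvge_to_le cvgA _; apply: nearW.
Qed.

Let cvg_tail A :
  phi (A `\` `I_n) @[n --> \oo] --> ereal_inf (range (fun n => phi (A `\` `I_n))).
Proof.
apply: ereal_nonincreasing_cvgn => m n mn.
by apply: phi_mono => i [Ai nin]; split=> // /leq_trans/(_ mn).
Qed.

Lemma submeasure_normE A : N A = ereal_inf (range (fun n => phi (A `\` `I_n))).
Proof. exact/cvg_lim/cvg_tail. Qed.

Lemma cvg_submeasure_norm A : phi (A `\` `I_n) @[n --> \oo] --> N A.
Proof. by rewrite submeasure_normE; exact: cvg_tail. Qed.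

Lemma submeasure_norm_le A n : N A <= phi (A `\` `I_n).
Proof. by rewrite submeasure_normE; apply: ereal_inf_lbound; exists n. Qed.

Lemma submeasure_norm_ltP A t :
  N A < t -> exists n, phi (A `\` `I_n) < t.
Proof. by rewrite submeasure_normE => /ereal_inf_lt[_ [n _ <-]]; exists n. Qed.

Lemma submeasure_norm_ge0 A : 0 <= N A.
Proof.
by rewrite submeasure_normE; apply: le_ereal_inf_tmp => _ [n _ <-].
Qed.

Lemma submeasure_norm_le_phi A : N A <= phi A.
Proof. by apply: le_trans (submeasure_norm_le A 0%N) _; apply: phi_mono => i []. Qed.

Lemma submeasure_norm_fin_num A : N A \is a fin_num.
Proof.
rewrite ge0_fin_numE ?submeasure_norm_ge0//.
apply: le_lt_trans (submeasure_norm_le_phi A) _.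
by rewrite -ge0_fin_numE ?submeasure_fin_num.
Qed.

(** The norm only sees tails, and beyond [maxn m n] the set [A] lies in the tail of [B]. *)
Lemma submeasure_norm_mono_mod_prefix A B m :
  A `<=` B `|` `I_m -> N A <= N B.
Proof.
move=> AB; rewrite (submeasure_normE B); apply: le_ereal_inf_tmp => _ [n _ <-].
apply: le_trans (submeasure_norm_le A (maxn m n)) _; apply: phi_mono.
move=> i [/AB ABi /=] /negP; rewrite -leqNgt geq_max => /andP[mi ni].
split; last by apply/negP; rewrite -leqNgt.
by case: ABi => //= im; rewrite ltnNge mi in im.
Qed.

Lemma submeasure_normU A B : N (A `|` B) <= N A + N B.
Proof.
have cvgNAB : phi (A `\` `I_n) + phi (B `\` `I_n) @[n --> \oo] --> N A + N B.
  apply: cvgeD; [|exact: cvg_submeasure_norm..].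
  by rewrite fin_num_adde_defl// submeasure_norm_fin_num.
rewrite -(cvg_lim _ cvgNAB)//; apply: lee_lim.
- by apply/cvg_ex; eexists; exact: cvg_submeasure_norm.
- by apply/cvg_ex; eexists; exact: cvgNAB.
- by apply: nearW => n; rewrite setDUl.
Qed.

(** The complement is open: a value above [t] is already exceeded on a finite prefix, hence by every
    point agreeing with [c] there. *)
Lemma closed_submeasure_tail_le (t : \bar R) m :
  closed [set c : cantor_space | phi ([set n | c n] `\` `I_m) <= t].
Proof.
rewrite -[X in closed X]setCK; apply: open_closedC.
rewrite openE => c /= /negP; rewrite -ltNge => tc.
have [n tcn] : exists n, t < phi (([set i | c i] `\` `I_m) `&` `I_n).
  apply: contrapT => nex; move: tc; apply/negP; rewrite -leNgt.
  apply: submeasure_le_prefix => n; rewrite leNgt; apply/negP => tcn.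
  by apply: nex; exists n.
apply: filterS (cantor_nbhs_prefix c n) => c' /= c'c; apply/negP.
rewrite -ltNge; apply: lt_le_trans tcn _; apply: phi_mono.
by move=> i /= [[ci mi] ni]; split => //=; rewrite c'c.
Qed.

(** A set of norm zero has a tail of value below [d]; conversely a tail of value at most [d] bounds
    the norm by [d], and the gap leaves only zero. *)
Lemma exh_Fsigma_of_gap (d : \bar R) : 0 < d ->
  (forall A, 0 < N A -> d < N A) ->
  Fsigma [set c : cantor_space | exh phi [set n | c n]].
Proof.
move=> d0 gap.
exists (fun m => [set c : cantor_space | phi ([set n | c n] `\` `I_m) <= d]).
  by move=> m; exact: closed_submeasure_tail_le.
apply/seteqP; split=> c /=.
  rewrite /exh /= => c0; have [|m cm] := submeasure_norm_ltP [set n | c n] d.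
    by rewrite c0.
  by exists m => //; exact: ltW.
move=> [m _ /= cm]; apply: contrapT => /eqP c0.
have /gap : 0 < N [set n | c n] by rewrite lt0e c0 submeasure_norm_ge0.
by apply/negP; rewrite -leNgt; exact: le_trans (submeasure_norm_le _ m) cm.
Qed.

(** * Construction of a partition from sets of arbitrarily small positive norm *)

Lemma partition_of_no_gap : ~ exh phi [set: nat] ->
  (forall d, 0 < d -> exists A, 0 < N A <= d) ->
  exists A : nat -> set nat,
    [/\ partition [set: nat] A [set: nat],
        forall n, 0 < N (A n)
      & N (\bigcup_(k in [set k | (n < k)%N]) A k) @[n --> \oo] --> 0].
Proof.
move=> nT nogap.
have /choice[step stepP] (p : nat * set nat) : exists B : set nat,
    0 < N p.2 -> [/\ 0 < N B, phi B <= (4^-1)%:E * N p.2,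
      phi B <= (p.1.+1%:R^-1)%:E & B `&` `I_p.1.+1 = set0].
  have [N0|N0] := pselect (0 < N p.2); last by exists set0.
  (* The quarter keeps all later sets together below half of the current norm; the reciprocal makes
     the values tend to zero. *)
  pose d : R := Num.min (4^-1 * fine (N p.2))%R (p.1.+1%:R^-1)%R.
  have d0 : (0 < d)%R.
    rewrite lt_min invr_gt0 ltr0n andbT mulr_gt0 ?invr_gt0//.
    by rewrite fine_gt0// N0 ltey_eq submeasure_norm_fin_num.
  have [A /andP[A0 Ad]] : exists A, 0 < N A <= (d / 2)%:E.
    by apply: nogap; rewrite lte_fin divr_gt0.
  have {Ad} [m Am] : exists n, phi (A `\` `I_n) < d%:E.
    apply: submeasure_norm_ltP; apply: le_lt_trans Ad _.
    by rewrite lte_fin; lra.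
  (* Cutting at [p.1.+1] as well ensures that each integer lies in only finitely many of the
     sets. *)
  pose q := maxn m p.1.+1.
  have Aq : phi (A `\` `I_q) <= d%:E.
    apply: le_trans (ltW Am); apply: phi_mono => i [Ai /= nin]; split=> // im.
    by apply: nin; rewrite leq_max im.
  exists (A `\` `I_q) => _; split.
  - apply: lt_le_trans A0 (submeasure_norm_mono_mod_prefix _ _ q _) => i Ai.
    by have [iq|iq] := pselect (i < q)%N; [right|left].
  - apply: le_trans Aq _; rewrite -(fineK (submeasure_norm_fin_num p.2)).
    by rewrite -EFinM lee_fin ge_min lexx.
  - by apply: le_trans Aq _; rewrite lee_fin ge_min lexx orbT.
  - rewrite -subset0 => i [[_ /= nin] ip]; apply: nin.
    by rewrite leq_max orbC (leq_trans ip).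
(* Starting from all of [nat] puts every integer in some [B n]. *)
pose B := fix B n := if n is n'.+1 then step (n', B n') else [set: nat].
have B0 n : 0 < N (B n).
  elim: n => [|n ih]; last by have [] := stepP (n, B n) ih.
  by rewrite lt0e submeasure_norm_ge0 andbT; apply/eqP.
have Bquarter n : phi (B n.+1) <= (4^-1)%:E * N (B n).
  by have [] := stepP (n, B n) (B0 n).
have Binv n : phi (B n.+1) <= (n.+1%:R^-1)%:E.
  by have [] := stepP (n, B n) (B0 n).
have Bdisj n i : (i <= n)%N -> ~ B n.+1 i.
  move=> ni Bi; have [_ _ _] := stepP (n, B n) (B0 n).
  by apply/eqP/set0P; exists i.
(* Peeling off [B n.+1] gives at most 3/2 of [phi (B n.+1)], that is 3/8 of the norm of [B n], so
   the constant 1/2 survives the induction. *)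
have tail_fin d n S : (forall i, S i -> exists2 k, (n < k <= n + d)%N & B k i) ->
    phi S <= (2^-1)%:E * N (B n).
  elim: d n S => [|d ih] n S Sk.
    have -> : S = set0.
      rewrite -subset0 => i /Sk[k]; rewrite addn0 => /andP[nk kn].
      by rewrite leqNgt nk in kn.
    have [_ -> _ _ _] := phi_lsc.
    by rewrite mule_ge0 // submeasure_norm_ge0.
  have SB : phi S <= phi (B n.+1) + (2^-1)%:E * N (B n.+1).
    apply: le_trans (phi_mono S (B n.+1 `|` (S `\` B n.+1)) _) _.
      by move=> i Si; have [|] := pselect (B n.+1 i); [left|right].
    apply: le_trans (phiU _ _) _; rewrite leeD2l//; apply: ih => i [/Sk].
    move=> [k /andP[nk kn] Bki] nB; exists k => //; rewrite addSnnS kn andbT.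
    by rewrite ltn_neqAle nk andbT; apply/eqP => nkE; apply: nB; rewrite nkE.
  apply: le_trans SB _.
  have := Bquarter n; have := submeasure_norm_le_phi (B n.+1).
  have := submeasure_norm_ge0 (B n.+1).
  rewrite -(fineK (submeasure_fin_num (B n.+1))).
  rewrite -(fineK (submeasure_norm_fin_num (B n.+1))).
  rewrite -(fineK (submeasure_norm_fin_num (B n))) -!EFinM -EFinD !lee_fin.
  lra.
pose T n := \bigcup_(k in [set k | (n < k)%N]) B k.
have phiT n : phi (T n) <= (2^-1)%:E * N (B n).
  (* An integer below [m] lies in no [B k] with [k > n + m], so [m] sets after [B n] suffice. *)
  apply: submeasure_le_prefix => m; apply: (tail_fin m) => i [[k /= nk Bki] im].
  exists k => //; rewrite nk /= leqNgt; apply/negP => mk.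
  case: k nk Bki mk => // k nk Bki mk; apply: (Bdisj k i) => //.
  exact: leq_trans (ltnW im) (leq_trans (leq_addl n m) mk).
(* Each integer goes to the last [B n] containing it. By subadditivity [A n] keeps at least half of
   the norm of [B n]. *)
pose A n := B n `\` T n.
have tailA n : \bigcup_(k in [set k | (n < k)%N]) A k `<=` T n.
  by move=> i [k /= nk [Bki _]]; exists k.
have NA n : 0 < N (A n).
  have BA : N (B n) <= N (A n) + (2^-1)%:E * N (B n).
    apply: le_trans (submeasure_norm_mono_mod_prefix (B n) (A n `|` T n) 0%N _) _.
      move=> i Bi; left; have [|] := pselect (T n i); [by right|by left].
    apply: le_trans (submeasure_normU _ _) _; rewrite leeD2l//.
    exact: le_trans (submeasure_norm_le_phi _) (phiT n).
  move: BA (B0 n); rewrite -(fineK (submeasure_norm_fin_num (A n))).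
  rewrite -(fineK (submeasure_norm_fin_num (B n))) -!EFinM -EFinD !lee_fin !lte_fin.
  lra.
exists A; split => //.
- split.
  + rewrite -subTset => i _.
    have [k [Bki kmax]] : exists k, B k i /\ forall j, B j i -> (j <= k)%N.
      have ex_k : exists k, `[< B k i >] by exists 0%N; exact/asboolP.
      have ub k : `[< B k i >] -> (k <= i)%N.
        move/asboolP; case: k => // k Bk; rewrite ltnNge; apply/negP => ik.
        exact: Bdisj Bk.
      exists (ex_maxn ex_k ub); case: ex_maxnP => k /asboolP Bk kmax.
      by split => // j Bj; apply/kmax/asboolP.
    by exists k => //; split => // -[j /= kj /kmax]; rewrite leqNgt kj.
  + apply/trivIsetP => i j _ _; wlog ij : i j / (i < j)%N => [wl|_].
      rewrite neq_ltn => /orP[ij|ji]; first by apply: wl => //; rewrite neq_ltn ij.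
      by rewrite setIC; apply: wl => //; rewrite neq_ltn ji.
    by rewrite -subset0 => m [[_ nT'] [Bj _]]; apply: nT'; exists j.
  + move=> n _; apply: contrapT => /nonemptyPn A0.
    have := lt_le_trans (NA n) (submeasure_norm_le_phi _); rewrite A0.
    by have [_ -> _ _ _] := phi_lsc; rewrite ltxx.
(* After the shift, the tail beyond [n.+1] is bounded by [phi (B n.+1)], hence by the [n]-th
   harmonic term. *)
- rewrite -cvg_shiftS.
  apply: (@squeeze_cvge _ _ _ R (fun=> 0) _ (EFin \o harmonic) _ 0
    (cvg_cst 0) cvge_harmonic).
  + apply: nearW => n; rewrite submeasure_norm_ge0 /=.
    apply: le_trans (submeasure_norm_le_phi _) _.
    apply: le_trans (phi_mono _ _ (tailA n.+1)) _.
    apply: le_trans (phiT n.+1) _; apply: le_trans _ (Binv n).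
    apply: le_trans (submeasure_norm_le_phi _).
    rewrite -(fineK (submeasure_norm_fin_num (B n.+1))) -EFinM lee_fin.
    by have := fine_ge0 (submeasure_norm_ge0 (B n.+1)); lra.
Qed.

(** * From a partition to a non-closed set of limit points *)

Lemma partition_limit_points_not_closed {X : topologicalType}
    {A : nat -> set nat} {l : X} {u : nat -> X} :
  hausdorff_space X -> u n @[n --> \oo] --> l -> (forall n, u n <> l) ->
  ideal (exh phi) -> partition [set: nat] A [set: nat] ->
  (forall n, 0 < N (A n)) ->
  N (\bigcup_(k in [set k | (n < k)%N]) A k) @[n --> \oo] --> 0 ->
  exists x : nat -> X, ~ closed (limit_points x (exh phi)).
Proof.
move=> X_hausdorff ul u_neq exh_ideal [Acover Atriv _] NA0 tailA.
have /choice[blk blkP] i : exists n, A n i.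
  have : [set: nat] i by [].
  by rewrite -Acover => -[n _ Ani]; exists n.
have blkE n i : A n i -> blk i = n.
  move=> Ani; apply/eqP/negP => /negP ne.
  move/trivIsetP : Atriv => /(_ _ _ I I ne); rewrite -subset0; apply.
  by split; [exact: blkP|exact: Ani].
(* Two goals remain: [l] is in the closure, through the values [u n] taken on whole blocks, and [l]
   is not itself a limit point. *)
exists (u \o blk) => /(_ l) [V|k [kincr xl]].
  move=> Vl; have [n _ nV] := ul _ Vl; exists (u n); split; last by apply: nV => /=.
  have nexhA : ~ exh phi (A n).
    by move=> A0; have := NA0 n; rewrite A0 ltxx.
  have [k kincr kA] :=
    infinite_nat_enum _ (not_ideal_infinite exh_ideal _ nexhA).
  exists k; split => //; last by rewrite kA.
  have -> : (fun n => (u \o blk) (k n)) = fun=> u n.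
    by apply/funext => j /=; rewrite (blkE n)// -kA; exists j.
  exact: cvg_cst.
apply.
have NE n : N (range k) <= N (\bigcup_(k in [set k | (n < k)%N]) A k).
  (* The finite set of the values [u 0], ..., [u n] is closed in a Hausdorff space and misses [l],
     so a subsequence tending to [l] eventually leaves the blocks up to [n]. *)
  have [m km] : exists m, forall j, (m <= j)%N -> (n < blk (k j))%N.
    have u_closed : closed (u @` `I_n.+1).
      have /accessible_finite_set_closed := hausdorff_accessible X_hausdorff.
      by apply; exact/finite_image/finite_II.
    have [|m _ mP] := xl (~` (u @` `I_n.+1)).
      apply: open_nbhs_nbhs; split; first exact: closed_openC.
      by move=> [i _ /u_neq].
    exists m => j mj; rewrite ltnNge; apply/negP => kn.
    by apply: (mP j mj); exists (blk (k j)).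
  apply: (submeasure_norm_mono_mod_prefix _ _ (k m)) => _ [j _ <-].
  have [mj|jm] := leqP m j.
    by left; exists (blk (k j)); [exact: km|exact: blkP].
  by right; rewrite /= ltnNge -leEnat kincr -ltnNge.
rewrite /exh /=; apply/eqP; rewrite eq_le submeasure_norm_ge0 andbT.
by apply: cvge_to_ge tailA _; exact: nearW.
Qed.
End Submeasure.

Theorem theorem2p5 (R : realType) (X : topologicalType)
    (X_first_countable : first_countable X)
    (X_hausdorff : hausdorff_space X)
    (X_cvg_seq : nontrivial_convergent_sequence X)
    (phi : set nat -> \bar R)
    (phi_lsc : lsc_submeasure phi)
    (phi_fin : phi [set: nat] < +oo)
    (exh_ideal : ideal (exh phi)) :
  [<-> Fsigma_ideal (exh phi);
       forall x : nat -> X,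
         limit_points x (exh phi) = cluster_points x (exh phi);
       forall x : nat -> X, closed (limit_points x (exh phi));
       ~ exists A : nat -> set nat,
         [/\ partition [set: nat] A [set: nat],
             forall n, 0 < submeasure_norm phi (A n)
           & submeasure_norm phi (\bigcup_(k in [set k | (n < k)%N]) A k)
               @[n --> \oo] --> 0]].
Proof.
have nexhT : ~ exh phi [set: nat].
  have [_ Isub _ Ineq] := exh_ideal => exhT; apply: Ineq.
  by rewrite -subTset => A _; exact: Isub exhT.
tfae.
- move=> Ifs x; apply/seteqP; split; first exact: limit_points_sub_cluster.
  exact: Fsigma_cluster_sub_limit_points.
- by move=> eq_pts x; rewrite eq_pts; exact: closed_cluster_points.
- move=> cl [A [Apart NA0 tailA]]; have [l [u [ul u_neq]]] := X_cvg_seq.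
  have [x] := partition_limit_points_not_closed phi_lsc X_hausdorff
    ul u_neq exh_ideal Apart NA0 tailA.
  by apply.
(* If the ideal is not F_sigma, no [d] can be a gap, so there are sets of arbitrarily small positive
   norm. *)
- move=> nopart; split=> //; apply: contrapT => nFs; apply: nopart.
  apply: partition_of_no_gap => // d d0; apply: contrapT => nA; apply: nFs.
  apply: (exh_Fsigma_of_gap phi_lsc d) => // A NA0; rewrite ltNge.
  by apply/negP => NAd; apply: nA; exists A; rewrite NA0.
Qed.
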